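(* Let $\alpha,\beta\in\mathbb{N}^{\ast}$ and $n\in\mathbb{N}^{\ast}$. Then \[ (n+1)\,q^{-\beta}\int_{\mathbb{Z}_p}q^{-\beta\xi}[1-\xi]_{q^{-\alpha}}^{n}\,d\mu_{-q^{\beta}}(\xi)=g_{n+1,q^{-1}}^{(\alpha,\beta)}(2). \]
   Context: Let $p$ be a fixed odd prime, $\mathbb{Z}_p$ the ring of $p$-adic integers, $\mathbb{C}_p$ the completion of an algebraic closure of $\mathbb{Q}_p$, and $q\in\mathbb{C}_p$ with $|q-1|_p<1$. $\mathbb{N}^{\ast}=\{0,1,2,\dots\}$. The $q$-number is $[x]_q=\frac{1-q^x}{1-q}$. For a uniformly differentiable function $f$ on $\mathbb{Z}_p$, the fermionic $p$-adic $q$-integral is \[ \int_{\mathbb{Z}_p}f(\xi)\,d\mu_{-q}(\xi)=\lim_{N\to\infty}\frac{1}{[p^N]_{-q}}\sum_{\xi=0}^{p^N-1}q^{\xi}f(\xi)(-1)^{\xi}, \] and $d\mu_{-q^{\gamma}}$ denotes the same with $q$ replaced by $q^{\gamma}$. The modified $q$-Genocchi polynomials with weight $\alpha$ and $\beta$ are defined for $n\in\mathbb{N}^{\ast}$ by \[ \frac{g_{n+1,q}^{(\alpha,\beta)}(x)}{n+1}=\int_{\mathbb{Z}_p}q^{-\beta\xi}[x+\xi]_{q^{\alpha}}^{n}\,d\mu_{-q^{\beta}}(\xi), \] with $g_{0,q}^{(\alpha,\beta)}=0$. The symbol $g_{n,q^{-1}}^{(\alpha,\beta)}(x)$ denotes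 the same object with $q$ replaced by $q^{-1}$ throughout, i.e. $\frac{g_{n+1,q^{-1}}^{(\alpha,\beta)}(x)}{n+1}=\int_{\mathbb{Z}_p}q^{\beta\xi}[x+\xi]_{q^{-\alpha}}^{n}\,d\mu_{-q^{-\beta}}(\xi)$. *)

(* Defs.v *)
From HB Require Import structures.
From mathcomp Require Import all_boot all_order all_algebra.
From mathcomp Require Import all_classical all_reals all_analysis.

Set Implicit Arguments.
Unset Strict Implicit.
Unset Printing Implicit Defensive.

Import Order.TTheory GRing.Theory Num.Theory.
Import numFieldNormedType.Exports.

Local Open Scope classical_set_scope.
Local Open Scope ring_scope.

Definition converges (R : realType) (K : fieldType) (abs : K -> R)
    (u : nat -> K) (l : K) : Prop :=
  (fun n => abs (u n - l)) @ \oo --> (0 : R).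

Definition padic_closure (R : realType) (K : fieldType) (abs : K -> R)
    (A : set K) : set K :=
  [set x | forall e : R, 0 < e -> exists2 a, A a & abs (x - a) < e].

(* In a complete K, the closure of the prime field is the completion of Q. *)
Definition Qp (R : realType) (K : fieldType) (abs : K -> R) : set K :=
  padic_closure abs (range (@ratr K)).

Definition Qpbar (R : realType) (K : fieldType) (abs : K -> R) : set K :=
  [set x | exists P : {poly K},
    [/\ P != 0, forall i, Qp abs P`_i & root P x]].

(* (K, abs) is a completion of an algebraic closure of Q_p.  The last two
   fields say that the elements of K algebraic over Q_p form an algebraically
   closed field (hence an algebraic closure of Q_p), and are dense in K.
   The normalization of |p|_p, with multiplicativity and the ultrametric
   inequality, forces characteristic 0 and |.|_p on Q. *)
Record is_Cp (p : nat) (R : realType) (K : fieldType) (abs : K -> R) : Prop :=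
  IsCp {
    abs_ge0 : forall x, 0 <= abs x ;
    abs_eq0 : forall x, abs x = 0 <-> x = 0 ;
    absM : forall x y, abs (x * y) = abs x * abs y ;
    abs_ultrametric : forall x y, abs (x + y) <= Num.max (abs x) (abs y) ;
    abs_p : abs p%:R = p%:R^-1 ;
    abs_complete : forall u : nat -> K,
      (forall e : R, 0 < e -> exists N : nat, forall m n : nat,
        (N <= m)%N -> (N <= n)%N -> abs (u m - u n) < e) ->
      exists l : K, converges abs u l ;
    Qpbar_closed : forall P : {poly K}, (1 < size P)%N ->
      (forall i, Qpbar abs P`_i) -> exists2 x, Qpbar abs x & root P x ;
    Qpbar_dense : padic_closure abs (Qpbar abs) = setT
  }.

Definition padic_lim (R : realType) (K : fieldType) (abs : K -> R)
    (u : nat -> K) : K :=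
  xget 0 [set l | converges abs u l].

(* q^x for x in Z_p and |q - 1|_p < 1: the value at x of the continuous
   extension to Z_p of m |-> q^m, m a natural number. *)
Definition qpow (R : realType) (K : fieldType) (abs : K -> R) (q x : K) : K :=
  xget 0 [set y | forall e : R, 0 < e -> exists2 d : R, 0 < d &
    forall m : nat, abs (m%:R - x) < d -> abs (q ^+ m - y) < e].

(* [x]_q for x in Z_p and |q - 1|_p < 1, with [x]_1 = x, the limit for
   q -> 1. *)
Definition qnumber (R : realType) (K : fieldType) (abs : K -> R)
    (q x : K) : K :=
  if q == 1 then x else (1 - qpow abs q x) / (1 - q).

(* [m]_q for m a natural number and arbitrary q: for the base -q,
   m |-> (-q)^m has no continuous extension to Z_p. *)
Definition qnumber_nat (K : fieldType) (q : K) (m : nat) : K :=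
  if q == 1 then m%:R else (1 - q ^+ m) / (1 - q).

(* A function on Z_p is given as a function on K, of which only the values on
   Z_p matter. *)
Definition fermionic_sum (p : nat) (K : fieldType) (q : K) (f : K -> K)
    (N : nat) : K :=
  (qnumber_nat (- q) (p ^ N))^-1 *
  \sum_(0 <= xi < p ^ N) q ^+ xi * f xi%:R * (-1) ^+ xi.

Definition fermionic_integrable (p : nat) (R : realType) (K : fieldType)
    (abs : K -> R) (q : K) (f : K -> K) : Prop :=
  exists l : K, converges abs (fermionic_sum p q f) l.

(* The integral of f against d mu_{-q}. *)
Definition fermionic_integral (p : nat) (R : realType) (K : fieldType)
    (abs : K -> R) (q : K) (f : K -> K) : K :=
  padic_lim abs (fermionic_sum p q f).

Definition genocchi_integrand (R : realType) (K : fieldType) (abs : K -> R)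
    (q : K) (alpha beta n : nat) (x xi : K) : K :=
  qpow abs q (- (beta%:R * xi)) * qnumber abs (q ^+ alpha) (x + xi) ^+ n.

Definition genocchi (p : nat) (R : realType) (K : fieldType) (abs : K -> R)
    (q : K) (alpha beta n : nat) (x : K) : K :=
  if n is m.+1 then
    m.+1%:R * fermionic_integral p abs (q ^+ beta)
                (genocchi_integrand abs q alpha beta m x)
  else 0.

(* Main.v *)
Require Import Defs.
From HB Require Import structures.
From mathcomp Require Import all_boot all_order all_algebra.
From mathcomp Require Import ring.
From mathcomp Require Import all_classical all_reals all_analysis.

Set Implicit Arguments.
Unset Strict Implicit.
Unset Printing Implicit Defensive.

Import Order.TTheory GRing.Theory Num.Theory.
Import numFieldNormedType.Exports.

Local Open Scope classical_set_scope.
Local Open Scope ring_scope.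

(** On natural arguments the weight [q^(-beta xi)] cancels the factor
    [q^(beta xi)] of the measure, so both integrals are limits of a normalizing factor times an
    alternating sum over [0 <= xi < p^N].  With [r = q^(-alpha)] and
    [c = max (1/p) |r - 1| < 1] one has [|[p^N]_r| <= c^N], whence
    [xi |-> [2 + xi]_r^n] moves by at most [c^N] under translation by [p^N]
    and its alternating sums converge.  The reflection [xi -> p^N - 1 - xi]
    turns [[1 - xi]_r] into [[2 + xi - p^N]_r], which is within [c^N] of
    [[2 + xi]_r], so both sides have the same alternating limit.  The
    normalizing factors tend to [(1 + q^beta)/2] and [(1 + q^(-beta))/2],
    whose quotient is [q^beta]. *)

(** * The ultrametric absolute value and its values on natural numbers *)

Section AbsoluteValue.
Variables (p : nat) (R : realType) (K : fieldType) (abs : K -> R).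
Hypotheses (p_prime : prime p) (CpK : is_Cp p abs).

Lemma abs_0 : abs 0 = 0.
Proof. exact/(abs_eq0 CpK). Qed.

Lemma abs_1 : abs 1 = 1.
Proof.
have nz : abs 1 != 0.
  by apply/eqP => /(abs_eq0 CpK)/eqP; rewrite oner_eq0.
by apply: (mulfI nz); rewrite -(absM CpK) !mulr1.
Qed.

Lemma abs_X x n : abs (x ^+ n) = abs x ^+ n.
Proof.
by elim: n => [|n IH]; rewrite ?expr0 ?abs_1 // !exprS (absM CpK) IH.
Qed.

Lemma abs_N x : abs (- x) = abs x.
Proof.
rewrite -mulN1r (absM CpK); suff -> : abs (-1) = 1 by rewrite mul1r.
apply/eqP; rewrite -(@eqrXn2 _ 2) ?(abs_ge0 CpK) //.
by rewrite -abs_X sqrrN !expr1n abs_1.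
Qed.

Lemma abs_V x : abs x^-1 = (abs x)^-1.
Proof.
have [->|x0] := eqVneq x 0; first by rewrite invr0 abs_0 invr0.
have ax0 : abs x != 0 by apply/eqP => /(abs_eq0 CpK)/eqP; exact/negP.
by apply: (mulfI ax0); rewrite -(absM CpK) !mulfV // abs_1.
Qed.

Lemma abs_distC x y : abs (x - y) = abs (y - x).
Proof. by rewrite -abs_N opprB. Qed.

Lemma abs_D_le e x y : abs x <= e -> abs y <= e -> abs (x + y) <= e.
Proof.
by move=> hx hy; apply: le_trans (abs_ultrametric CpK x y) _; rewrite ge_max hx.
Qed.

Lemma abs_D_lt e x y : abs x < e -> abs y < e -> abs (x + y) < e.
Proof.
move=> hx hy; apply: le_lt_trans (abs_ultrametric CpK x y) _.
by rewrite gt_max hx.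
Qed.

Lemma abs_sum_le (I : Type) (s : seq I) (P : pred I) (F : I -> K) e :
  0 <= e -> (forall i, P i -> abs (F i) <= e) ->
  abs (\sum_(i <- s | P i) F i) <= e.
Proof.
by move=> e0 hF; elim/big_ind: _ => //; [rewrite abs_0 | exact: abs_D_le].
Qed.

Lemma abs_nat_le1 n : abs n%:R <= 1.
Proof.
elim: n => [|n IH]; first by rewrite abs_0.
by rewrite -natr1 abs_D_le ?abs_1.
Qed.

(** If [abs x < 1], then [1 = x - (x - 1)] would have absolute value below 1. *)
Lemma abs_near1 x : abs (x - 1) < 1 -> abs x = 1.
Proof.
move=> hx; apply/eqP; rewrite eq_le; apply/andP; split.
  by rewrite -(subrK 1 x) abs_D_le ?abs_1 ?(ltW hx).
rewrite leNgt; apply/negP => x1.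
have := abs_D_lt x1 (_ : abs (- (x - 1)) < 1).
by rewrite abs_N subKr abs_1 ltxx => /(_ hx).
Qed.

Lemma invp_lt1 : (p%:R^-1 : R) < 1.
Proof. by rewrite invf_lt1 ?ltr1n ?ltr0n ?prime_gt1 ?prime_gt0. Qed.

(** Bezout gives [u p = v m + 1]. Since [abs (u p) <= 1/p < 1], the number [- v m] is close to 1, so
    [abs (v m) = 1]; as neither factor exceeds 1, [abs m = 1]. *)
Lemma abs_nat_coprime m : coprime p m -> abs m%:R = 1.
Proof.
case/coprimeP => [|[u v] /= huv]; first exact: prime_gt0.
have uvE : (u * p)%N = (v * m + 1)%N.
  have : (v * m <= u * p)%N by rewrite ltnW // -subn_gt0 huv.
  by move/subnKC <-; rewrite huv.
have vm1 : abs (v%:R * m%:R) = 1.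
  rewrite -abs_N; apply: abs_near1.
  rewrite -opprD abs_N -natrM -[1]/(1%:R) -natrD -uvE natrM (absM CpK).
  by rewrite (abs_p CpK) (le_lt_trans (ler_piMl _ (abs_nat_le1 u))) ?invp_lt1.
apply/eqP; rewrite eq_le abs_nat_le1 /= -[leLHS]vm1 (absM CpK).
by rewrite ler_piMl ?abs_nat_le1 ?(abs_ge0 CpK).
Qed.

(** Writing [m = m' p^j] with [m'] prime to [p] gives [abs m = p^-j], so the bound forces
    [k <= j]. *)
Lemma dvdn_abs k m : abs m%:R <= p%:R^-1 ^+ k -> (p ^ k %| m)%N.
Proof.
have [->//|m0] := posnP m.
have [m' pm' ->] := pfactor_coprime p_prime m0.
rewrite natrM natrX (absM CpK) abs_nat_coprime // mul1r abs_X (abs_p CpK).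
rewrite ler_iXn2l ?invr_gt0 ?ltr0n ?prime_gt0 ?invp_lt1 //.
by move=> kj; rewrite dvdn_mull // dvdn_exp2l.
Qed.

Lemma abs_subX_le n x y : abs x <= 1 -> abs y <= 1 ->
  abs (x ^+ n - y ^+ n) <= abs (x - y).
Proof.
move=> hx hy; rewrite subrXX (absM CpK) ler_piMr ?(abs_ge0 CpK) //.
apply: abs_sum_le => // i _; rewrite (absM CpK) !abs_X.
by rewrite mulr_ile1 ?exprn_ile1 ?exprn_ge0 ?(abs_ge0 CpK).
Qed.

(** * Limits of sequences *)

Lemma convergesP (u : nat -> K) l :
  converges abs u l <->
  forall e, 0 < e -> exists N, forall n, (N <= n)%N -> abs (u n - l) < e.
Proof.
split=> [/cvgr0Pnorm_lt ul e /ul [N _ hN]|ul].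
  by exists N => n /hN /=; rewrite ger0_norm ?(abs_ge0 CpK).
apply/cvgr0Pnorm_lt => e /ul [N hN]; exists N => // n /hN /=.
by rewrite ger0_norm ?(abs_ge0 CpK).
Qed.

Lemma converges_unique (u : nat -> K) l m :
  converges abs u l -> converges abs u m -> l = m.
Proof.
move=> /convergesP ul /convergesP um; apply/eqP; rewrite -subr_eq0; apply/eqP.
apply/(abs_eq0 CpK)/eqP; rewrite eq_le (abs_ge0 CpK) andbT leNgt.
apply/negP => /[dup] /ul [N hN] /um [M hM].
have := hN _ (leq_maxl N M); rewrite abs_distC => /abs_D_lt/(_ (hM _ (leq_maxr N M))).
by rewrite addrA subrK ltxx.
Qed.

Lemma padic_limE (u : nat -> K) l : converges abs u l -> padic_lim abs u = l.
Proof.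
move=> ul; apply: xget_subset1 => // x y hx hy; exact: converges_unique hx hy.
Qed.

Lemma converges_geometric (c : R) (u : nat -> K) l : 0 <= c < 1 ->
  (forall n, abs (u n - l) <= c ^+ n) -> converges abs u l.
Proof.
move=> /andP[c0 c1] ul; apply/convergesP => e.
have /cvg_expr/cvgr0Pnorm_lt/[apply] : `|c| < 1 by rewrite ger0_norm.
move=> [N _ hN]; exists N => n /hN /=; rewrite ger0_norm ?exprn_ge0 //.
exact: le_lt_trans.
Qed.

Lemma converges_close (u v : nat -> K) l :
  converges abs (fun n => u n - v n) 0 -> converges abs v l ->
  converges abs u l.
Proof.
move=> /convergesP uv /convergesP vl; apply/convergesP => e /[dup] /uv [N hN].
move=> /vl [M hM]; exists (maxn N M) => n; rewrite geq_max => /andP[/hN un /hM vn].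
by rewrite subr0 in un; have := abs_D_lt un vn; rewrite addrA subrK.
Qed.

Lemma convergesM (u v : nat -> K) l m :
  converges abs u l -> converges abs v m ->
  converges abs (fun n => u n * v n) (l * m).
Proof.
move=> /convergesP ul /convergesP vm; apply/convergesP => e e0.
(* The summand 1 keeps [A] and [B] positive as divisors, and lets [B] bound [abs (v n)] once [v n]
   is within 1 of [m]. *)
pose A := 1 + abs l; pose B := 1 + abs m.
have A0 : 0 < A by rewrite ltr_pwDl ?(abs_ge0 CpK).
have B0 : 0 < B by rewrite ltr_pwDl ?(abs_ge0 CpK).
have [N hN] := ul _ (divr_gt0 e0 B0).
have [M hM] := vm _ (divr_gt0 e0 A0).
have [M1 hM1] := vm _ ltr01.
exists (maxn N (maxn M M1)) => n; rewrite !geq_max.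
move=> /andP[/hN un /andP[/hM vn /hM1 vn1]].
have -> : u n * v n - l * m = (u n - l) * v n + l * (v n - m) by ring.
apply: abs_D_lt; rewrite (absM CpK).
  have vnB : abs (v n) <= B.
    rewrite -(subrK m (v n)); apply: le_trans (abs_ultrametric CpK _ _) _.
    by rewrite ge_max (le_trans (ltW vn1)) /= /B ?lerDr ?lerDl ?(abs_ge0 CpK).
  rewrite -(divfK (lt0r_neq0 B0) e).
  by apply: le_lt_trans (ler_wpM2l (abs_ge0 CpK _) vnB) _; rewrite ltr_pM2r.
rewrite -(divfK (lt0r_neq0 A0) e) mulrC.
apply: le_lt_trans (_ : abs (v n - m) * A < _); last by rewrite ltr_pM2r.
by rewrite ler_wpM2l ?(abs_ge0 CpK) // lerDr.
Qed.

(** By the ultrametric inequality a telescoping sum is no larger than its largest step, so all terms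
    from [N] on lie within [c^N] of [u N]. *)
Lemma converges_of_geometric_steps (c : R) (u : nat -> K) : 0 <= c < 1 ->
  (forall n, abs (u n.+1 - u n) <= c ^+ n) ->
  exists l, converges abs u l.
Proof.
move=> /[dup] c01 /andP[c0 c1] du.
have tail N k : abs (u (N + k)%N - u N) <= c ^+ N.
  elim: k => [|k IH]; first by rewrite addn0 subrr abs_0 exprn_ge0.
  have -> : u (N + k.+1)%N - u N =
      (u (N + k).+1 - u (N + k)%N) + (u (N + k)%N - u N).
    by rewrite addnS addrA subrK.
  rewrite abs_D_le // (le_trans (du _)) // exprD ler_piMr ?exprn_ge0 //.
  by rewrite exprn_ile1 // ltW.
apply: (abs_complete CpK) => e.
have /cvg_expr/cvgr0Pnorm_lt/[apply] : `|c| < 1 by rewrite ger0_norm.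
move=> [N _ /(_ N (leqnn N)) /=]; rewrite ger0_norm ?exprn_ge0 // => cN.
exists N => m n /subnKC <- /subnKC <-.
rewrite -(subrK (u N) (u (N + (m - N))%N)) -addrA; apply: le_lt_trans cN.
by apply: abs_D_le => //; rewrite abs_distC.
Qed.

(** * q-numbers of natural numbers, and their size for a base close to 1 *)

Lemma qnumber_natE (r : K) m : qnumber_nat r m = \sum_(i < m) r ^+ i.
Proof.
rewrite /qnumber_nat; have [->|r1] := eqVneq r 1.
  by under eq_bigr do rewrite expr1n; rewrite sumr_const card_ord.
have r1' : 1 - r != 0 by rewrite subr_eq0 eq_sym.
by apply: (mulIf r1'); rewrite divfK // -opprB subrX1 -mulNr opprB mulrC.
Qed.

Lemma subX1_qnumber_nat (r : K) m : r ^+ m - 1 = (r - 1) * qnumber_nat r m.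
Proof. by rewrite subrX1 qnumber_natE. Qed.

Lemma qnumber_natD (r : K) m n :
  qnumber_nat r (m + n) = qnumber_nat r m + r ^+ m * qnumber_nat r n.
Proof.
rewrite !qnumber_natE big_split_ord mulr_sumr; congr (_ + _).
by apply: eq_bigr => i _; rewrite -exprD.
Qed.

Lemma qnumber_natM (r : K) m n :
  qnumber_nat r (m * n) = qnumber_nat r m * qnumber_nat (r ^+ m) n.
Proof.
elim: n => [|n IH]; first by rewrite muln0 !qnumber_natE !big_ord0 mulr0.
rewrite mulnS qnumber_natD IH -add1n qnumber_natD.
by rewrite (qnumber_natE _ 1) big_ord1; ring.
Qed.

Section Base.
Variable r : K.
Hypothesis hr : abs (r - 1) < 1.

Let ar : abs r = 1. Proof. exact: abs_near1. Qed.

Lemma near1_neq0 : r != 0.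
Proof.
by apply/eqP => r0; move: ar; rewrite r0 abs_0 => /esym/eqP; rewrite oner_eq0.
Qed.

Lemma abs_near1X m : abs (r ^+ m) = 1.
Proof. by rewrite abs_X ar expr1n. Qed.

Lemma near1V : abs (r^-1 - 1) < 1.
Proof.
have -> : r^-1 - 1 = r^-1 * (1 - r) by rewrite mulrBr mulr1 mulVf ?near1_neq0.
by rewrite (absM CpK) abs_V ar invr1 mul1r abs_distC.
Qed.

Lemma abs_qnumber_nat_le1 m : abs (qnumber_nat r m) <= 1.
Proof.
by rewrite qnumber_natE; apply: abs_sum_le => // i _; rewrite abs_near1X.
Qed.

Lemma abs_subX1_le m : abs (r ^+ m - 1) <= abs (r - 1).
Proof.
rewrite subX1_qnumber_nat (absM CpK).
by rewrite ler_piMr ?(abs_ge0 CpK) ?abs_qnumber_nat_le1.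
Qed.

Lemma abs_subX1_le_qnumber_nat m : abs (r ^+ m - 1) <= abs (qnumber_nat r m).
Proof.
by rewrite subX1_qnumber_nat (absM CpK) ler_piMl ?(abs_ge0 CpK) // ltW.
Qed.

Lemma near1X m : abs (r ^+ m - 1) < 1.
Proof. exact: le_lt_trans (abs_subX1_le m) hr. Qed.

End Base.

(** Splitting each [r^i] as [1 + (r^i - 1)] turns the sum into [p] plus terms bounded by
    [abs (r - 1)]. *)
Lemma abs_qnumber_nat_p (r : K) : abs (r - 1) < 1 ->
  abs (qnumber_nat r p) <= Num.max p%:R^-1 (abs (r - 1)).
Proof.
move=> hr; rewrite qnumber_natE.
have -> : \sum_(i < p) r ^+ i = p%:R + \sum_(i < p) (r ^+ i - 1).
  by rewrite sumrB sumr_const card_ord addrC subrK.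
apply: abs_D_le; first by rewrite (abs_p CpK) le_max lexx.
apply: abs_sum_le => [|i _]; first by rewrite le_max (abs_ge0 CpK) orbT.
by rewrite le_max abs_subX1_le ?orbT.
Qed.

(** The common ratio [c] of all the geometric estimates below. *)
Definition near1_rate (r : K) : R := Num.max p%:R^-1 (abs (r - 1)).

Lemma near1_rate_itv (r : K) : abs (r - 1) < 1 -> 0 <= near1_rate r < 1.
Proof. by move=> hr; rewrite le_max (abs_ge0 CpK) orbT gt_max invp_lt1. Qed.

(* [p^(k+1)]_r = [p^k]_r [p]_s with s = r^(p^k), and |s - 1| <= |r - 1|. *)
Lemma abs_qnumber_nat_pX (r : K) k : abs (r - 1) < 1 ->
  abs (qnumber_nat r (p ^ k)) <= near1_rate r ^+ k.
Proof.
move=> hr; have /andP[c0 _] := near1_rate_itv hr.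
elim: k => [|k IH]; first by rewrite abs_qnumber_nat_le1.
rewrite expnSr qnumber_natM (absM CpK) exprSr ler_pM ?(abs_ge0 CpK) //.
apply: le_trans (abs_qnumber_nat_p (near1X hr _)) _.
by rewrite ge_max !le_max lexx /= abs_subX1_le ?orbT.
Qed.

(** Uniform continuity of [m |-> r^m] in the p-adic topology: [p^k] divides [m - n], so a power of
    [r^(p^k)] can be split off, and [r^(p^k) - 1 = (r - 1) [p^k]_r]. *)
Lemma abs_subX_dvdn (r : K) k m n : abs (r - 1) < 1 ->
  abs (m%:R - n%:R) <= p%:R^-1 ^+ k ->
  abs (r ^+ m - r ^+ n) <= near1_rate r ^+ k.
Proof.
move=> hr; wlog nm : m n / (n <= m)%N => [H mn|].
  have [/H|/ltnW/H] := leqP n m; first exact.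
  by rewrite abs_distC [abs (_ - r ^+ n)]abs_distC; exact.
rewrite -natrB // => /dvdn_abs/dvdnP[d dE].
have -> : r ^+ m - r ^+ n = r ^+ n * ((r ^+ (p ^ k)) ^+ d - 1).
  by rewrite -exprM mulnC -dE mulrBr -exprD subnKC // mulr1.
rewrite (absM CpK) abs_near1X // mul1r (le_trans (abs_subX1_le (near1X hr _) _)) //.
by rewrite (le_trans (abs_subX1_le_qnumber_nat hr _)) // abs_qnumber_nat_pX.
Qed.

(** * Powers and q-numbers at integer exponents [a - b] *)

Lemma qpowE (r : K) a b : abs (r - 1) < 1 ->
  qpow abs r (a%:R - b%:R) = r ^+ a / r ^+ b.
Proof.
move=> hr; have arb := abs_near1X hr b.
have rb0 : r ^+ b != 0 by rewrite expf_neq0 // near1_neq0.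
have ip01 : 0 <= (p%:R^-1 : R) < 1 by rewrite invr_ge0 ler0n invp_lt1.
have pow0 (c : R) : 0 <= c < 1 -> forall e, 0 < e -> exists k, c ^+ k < e.
  move=> /andP[c0 c1] e; have : `|c| < 1 by rewrite ger0_norm.
  move=> /cvg_expr/cvgr0Pnorm_lt/[apply] -[N _ /(_ N (leqnn N)) /=].
  by rewrite ger0_norm ?exprn_ge0 //; exists N.
apply: xget_subset1.
  (* Existence: up to the factor [r^b], of absolute value 1, the error is [r^(m + b) - r^a], where
     [m + b] is close to [a]. *)
  move=> e /(pow0 _ (near1_rate_itv hr)) [k hk].
  exists (p%:R^-1 ^+ k); first by rewrite exprn_gt0 // invr_gt0 ltr0n prime_gt0.
  move=> m hm; apply: le_lt_trans hk.
  have -> : r ^+ m - r ^+ a / r ^+ b = (r ^+ (m + b) - r ^+ a) / r ^+ b.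
    by rewrite mulrBl exprD mulfK.
  rewrite (absM CpK) abs_V arb invr1 mulr1; apply: abs_subX_dvdn => //.
  by rewrite ltW //; move: hm; rewrite natrD opprB addrA.
(* Uniqueness: otherwise take [e = abs (x - y)]; a natural [m] close enough to [a - b] puts [r^m]
   within [e] of both [x] and [y], against the ultrametric inequality. *)
move=> x y hx hy; apply/eqP; rewrite -subr_eq0; apply/eqP.
apply/(abs_eq0 CpK)/eqP; rewrite eq_le (abs_ge0 CpK) andbT leNgt.
apply/negP => /[dup] /hx [d d0 hd] /hy [d' d'0 hd'].
have [k] : exists k, p%:R^-1 ^+ k < Num.min d d'.
  by apply: pow0 => //; rewrite lt_min d0.
rewrite lt_min => /andP[kd kd'].
(* a - b + b p^k is a natural number close to a - b *)
pose m := (a + b * (p ^ k).-1)%N.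
have mE : abs (m%:R - (a%:R - b%:R)) <= p%:R^-1 ^+ k.
  have -> : m%:R - (a%:R - b%:R) = (b * p ^ k)%:R :> K.
    rewrite /m -[in RHS](prednK (_ : 0 < p ^ k)%N) ?expn_gt0 ?prime_gt0 //.
    by rewrite mulnS !natrD; ring.
  by rewrite natrM natrX (absM CpK) abs_X (abs_p CpK) ler_piMl ?abs_nat_le1.
have := hd m (le_lt_trans mE kd); rewrite abs_distC => /abs_D_lt.
move=> /(_ _ (hd' m (le_lt_trans mE kd'))).
by rewrite addrA subrK ltxx.
Qed.

Lemma qpowNE (r : K) a : abs (r - 1) < 1 -> qpow abs r (- a%:R) = r ^- a.
Proof. by move=> hr; have := qpowE 0 a hr; rewrite sub0r expr0 mul1r. Qed.

Lemma qnumberE (r : K) a b : abs (r - 1) < 1 ->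
  qnumber abs r (a%:R - b%:R) = (qnumber_nat r a - qnumber_nat r b) / r ^+ b.
Proof.
move=> hr; rewrite /qnumber /qnumber_nat; case: eqP => [->|/eqP r1].
  by rewrite expr1n divr1.
have r1' : 1 - r != 0 by rewrite subr_eq0 eq_sym.
have rb0 : r ^+ b != 0 by rewrite expf_neq0 // near1_neq0.
by rewrite qpowE //; field; rewrite r1' rb0.
Qed.

Lemma qnumber_natr (r : K) a : abs (r - 1) < 1 ->
  qnumber abs r a%:R = qnumber_nat r a.
Proof.
move=> hr; have := qnumberE a 0 hr; rewrite subr0 => ->.
by rewrite qnumber_natE (qnumber_natE _ 0) big_ord0 subr0 divr1.
Qed.

(** * Alternating sums of nearly periodic functions *)

Hypothesis p_odd : odd p.

Definition alternating_sum (f : nat -> K) (n : nat) : K :=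
  \sum_(0 <= i < n) (-1) ^+ i * f i.

(** Cut the sum into [j] blocks of length [P]. As [P] is odd, block [i] carries the sign [(-1)^i],
    and up to an error [e] it repeats the first block; these signs add up to [odd j]. *)
Lemma alternating_sum_period (f : nat -> K) P e j : odd P -> 0 <= e ->
  (forall m, abs (f (m + P)%N - f m) <= e) ->
  abs (alternating_sum f (j * P) - (odd j)%:R * alternating_sum f P) <= e.
Proof.
move=> oddP e0 hf.
have hfj i m : abs (f (m + i * P)%N - f m) <= e.
  elim: i => [|i IH]; first by rewrite addn0 subrr abs_0.
  rewrite -(subrK (f (m + i * P)%N) (f _)) -addrA abs_D_le //.
  by rewrite mulSn addnCA addnC hf.
elim: j => [|j IH].
  by rewrite /alternating_sum mul0n big_geq // mul0r subr0 abs_0.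
(* [D] is the deviation of block [j], sign removed, from the first block. *)
pose D := \sum_(0 <= i < P) (-1) ^+ i * (f (i + j * P)%N - f i).
have sumE : alternating_sum f (j.+1 * P) =
    alternating_sum f (j * P) + (-1) ^+ j * (alternating_sum f P + D).
  rewrite /alternating_sum (@big_cat_nat _ _ _ (j * P)) ?leq_mul //=.
  congr (_ + _); rewrite -{1}[(j * P)%N]add0n big_addn mulSn addnK.
  rewrite -big_split mulr_sumr; apply: eq_bigr => i _ /=.
  rewrite -mulrDr addrC subrK mulrA; congr (_ * _).
  by rewrite -exprD addnC -signr_odd oddD oddM oddP andbT -oddD signr_odd.
have -> : alternating_sum f (j.+1 * P) - (odd j.+1)%:R * alternating_sum f P =
    (alternating_sum f (j * P) - (odd j)%:R * alternating_sum f P) +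
    (-1) ^+ j * D.
  by rewrite sumE -[(-1) ^+ j]signr_odd /=; case: (odd j); rewrite /=; ring.
apply: abs_D_le => //; rewrite (absM CpK) abs_X abs_N abs_1 expr1n mul1r.
apply: abs_sum_le => // i _.
by rewrite (absM CpK) abs_X abs_N abs_1 expr1n mul1r.
Qed.

(** The sum up to [p^(N+1)] consists of [p] blocks of length [p^N]; [p] being odd, exactly one block
    survives up to [c^N]. *)
Lemma alternating_sum_converges (c : R) (f : nat -> K) : 0 <= c < 1 ->
  (forall N m, abs (f (m + p ^ N)%N - f m) <= c ^+ N) ->
  exists l, converges abs (fun N => alternating_sum f (p ^ N)) l.
Proof.
move=> c01 hf; apply: (converges_of_geometric_steps c01) => N.
have := @alternating_sum_period f (p ^ N) (c ^+ N) p.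
rewrite p_odd mul1r expnS; apply => //; first by rewrite oddX p_odd orbT.
by rewrite exprn_ge0 //; case/andP: c01.
Qed.

(** * Normalizing factors and fermionic sums *)

Lemma abs_2 : abs 2%:R = 1.
Proof. by apply: abs_nat_coprime => //; rewrite coprimen2. Qed.

Lemma two_neq0 : 2%:R != 0 :> K.
Proof.
by apply/eqP => h; have := abs_2; rewrite h abs_0 => /esym/eqP; rewrite oner_eq0.
Qed.

(** For odd [P] the factor is [(1 + Q) / (1 + Q^P)], and [Q^P] tends to 1 along [P = p^N]. *)
Lemma qnumber_natN_converges (Q : K) : abs (Q - 1) < 1 ->
  converges abs (fun N => (qnumber_nat (- Q) (p ^ N))^-1) ((1 + Q) / 2%:R).
Proof.
move=> hQ; apply: (converges_geometric (near1_rate_itv hQ)) => N.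
(* [(1 + s)/2] differs from 1 by [(1 - s)/2], and [abs 2 = 1] because [p] is odd. *)
have a1s s : abs (s - 1) < 1 -> abs (1 + s) = 1.
  move=> hs; have hh : abs ((1 - s) / 2%:R) < 1.
    by rewrite (absM CpK) abs_V abs_2 invr1 mulr1 abs_distC.
  have : abs ((1 + s) / 2%:R) = 1.
    apply: abs_near1; rewrite -abs_N.
    suff -> : - ((1 + s) / 2%:R - 1) = (1 - s) / 2%:R by [].
    by field; exact: two_neq0.
  by rewrite (absM CpK) abs_V abs_2 invr1 mulr1.
have n0 s : abs (s - 1) < 1 -> 1 + s != 0.
  move=> /a1s h; apply/eqP => h0; move: h.
  by rewrite h0 abs_0 => /esym/eqP; rewrite oner_eq0.
have hQN := near1X hQ (p ^ N).
(* This selects the quotient branch of [qnumber_nat] at the base [- Q]. *)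
have NQ1 : (- Q == 1) = false.
  by rewrite eqr_oppLR -addr_eq0 addrC (negbTE (n0 _ hQ)).
rewrite /qnumber_nat NQ1 exprNn -signr_odd oddX p_odd orbT expr1 mulN1r !opprK.
have -> : ((1 + Q ^+ (p ^ N)) / (1 + Q))^-1 - (1 + Q) / 2%:R =
    (1 + Q) / (1 + Q ^+ (p ^ N)) / 2%:R * (1 - Q ^+ (p ^ N)).
  by field; rewrite two_neq0 !n0.
rewrite !(absM CpK) !abs_V abs_2 (a1s _ hQ) (a1s _ hQN) !invr1 !mul1r abs_distC.
by rewrite (le_trans (abs_subX1_le_qnumber_nat hQ _)) // abs_qnumber_nat_pX.
Qed.

Lemma fermionic_sum_converges (q : K) (beta : nat) (h : K -> K) s :
  abs (q - 1) < 1 ->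
  converges abs (fun N => alternating_sum (fun i => h i%:R) (p ^ N)) s ->
  converges abs
    (fermionic_sum p (q ^+ beta)
       (fun xi => qpow abs q (- (beta%:R * xi)) * h xi))
    ((1 + q ^+ beta) / 2%:R * s).
Proof.
move=> hq hs.
have := convergesM (qnumber_natN_converges (near1X hq beta)) hs.
congr converges; apply/funext => N; congr (_ * _); apply: eq_bigr => i _.
rewrite -natrM qpowNE // -exprM mulrA mulfV ?mul1r 1?mulrC //.
by rewrite expf_neq0 // near1_neq0.
Qed.

(** * Reflection of alternating sums of q-number powers *)

Lemma alternating_sum_rev (f : nat -> K) P : odd P ->
  alternating_sum f P = alternating_sum (fun i => f (P - i.+1)%N) P.
Proof.
move=> oddP; rewrite /alternating_sum big_nat_rev /= !big_nat.
apply: eq_bigr => i /= iP; rewrite add0n; congr (_ * _).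
(* [P - 1] is even, so [i] and [P - 1 - i] have the same parity. *)
by rewrite -signr_odd oddB // oddP /= negbK signr_odd.
Qed.

Section QnumberSums.
Variables (r : K) (n : nat).
Hypothesis hr : abs (r - 1) < 1.

Lemma alternating_qnumber_converges : exists s,
  converges abs
    (fun N => alternating_sum (fun i => qnumber abs r (2%:R + i%:R) ^+ n) (p ^ N))
    s.
Proof.
apply: (alternating_sum_converges (near1_rate_itv hr)) => N m.
rewrite -!natrD !qnumber_natr // addnA.
apply: le_trans (abs_subX_le _ _ _) _; rewrite ?abs_qnumber_nat_le1 //.
(* What remains of the difference is [r^(2 + m) [p^N]_r]. *)
rewrite [X in X - _]qnumber_natD [X in X - _]addrC addrK.
by rewrite (absM CpK) abs_near1X // mul1r abs_qnumber_nat_pX.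
Qed.

Lemma alternating_qnumber_reflect s :
  converges abs
    (fun N => alternating_sum (fun i => qnumber abs r (2%:R + i%:R) ^+ n) (p ^ N))
    s ->
  converges abs
    (fun N => alternating_sum (fun i => qnumber abs r (1 - i%:R) ^+ n) (p ^ N))
    s.
Proof.
apply: converges_close; apply: (converges_geometric (near1_rate_itv hr)) => N.
have /andP[c0 _] := near1_rate_itv hr.
rewrite subr0 alternating_sum_rev ?oddX ?p_odd ?orbT //.
rewrite /alternating_sum -sumrB big_nat; apply: abs_sum_le => [|i /= iP].
  exact: exprn_ge0.
rewrite -mulrBr (absM CpK) abs_X abs_N abs_1 expr1n mul1r.
have -> : 1 - (p ^ N - i.+1)%:R = (2 + i)%:R - (p ^ N)%:R :> K.
  by rewrite natrB // -natr1 natrD; ring.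
have rP : r ^+ (p ^ N) != 0 by rewrite expf_neq0 // near1_neq0.
rewrite -natrD qnumber_natr // qnumberE //.
set a := qnumber_nat r (2 + i); set b := qnumber_nat r (p ^ N).
have a1 : abs a <= 1 by exact: abs_qnumber_nat_le1.
have b1 : abs b <= 1 by exact: abs_qnumber_nat_le1.
apply: le_trans (abs_subX_le _ _ a1) _.
  by rewrite (absM CpK) abs_V abs_near1X // invr1 mulr1; apply: abs_D_le; rewrite ?abs_N.
(* Both [r^(p^N) - 1] and [b] are bounded by [abs b], hence by [c^N], while [abs a <= 1]. *)
have -> : (a - b) / r ^+ (p ^ N) - a =
    - ((r ^+ (p ^ N) - 1) * a + b) / r ^+ (p ^ N).
  by field.
rewrite (absM CpK) abs_V abs_near1X // invr1 mulr1 abs_N.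
apply: le_trans (abs_qnumber_nat_pX _ hr); rewrite -/b abs_D_le //.
rewrite (absM CpK); apply: le_trans (abs_subX1_le_qnumber_nat hr _).
by rewrite ler_piMr ?(abs_ge0 CpK).
Qed.

End QnumberSums.

End AbsoluteValue.

(** * Comparison of the two integrals *)

Theorem theorem5 (p : nat) (p_prime : prime p) (p_odd : odd p)
    (R : realType) (K : fieldType) (abs : K -> R) (CpK : is_Cp p abs)
    (q : K) (hq : abs (q - 1) < 1) (alpha beta n : nat) :
  let f := fun xi : K => qpow abs q (- (beta%:R * xi)) *
                         qnumber abs (q ^- alpha) (1 - xi) ^+ n in
  [/\ fermionic_integrable p abs (q ^+ beta) f,
      fermionic_integrable p abs (q^-1 ^+ beta)
        (genocchi_integrand abs q^-1 alpha beta n 2%:R) &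
      n.+1%:R * q ^- beta * fermionic_integral p abs (q ^+ beta) f =
      genocchi p abs q^-1 alpha beta n.+1 2%:R].
Proof.
move=> f.
have hqV := near1V CpK hq.
have hr : abs (q ^- alpha - 1) < 1 by exact: (near1V CpK (near1X CpK hq alpha)).
have [s hs] := alternating_qnumber_converges p_prime CpK p_odd n hr.
have lims := fermionic_sum_converges p_prime CpK p_odd.
have hf : converges abs (fermionic_sum p (q ^+ beta) f)
    ((1 + q ^+ beta) / 2%:R * s).
  apply: (lims _ _ (fun xi => qnumber abs (q ^- alpha) (1 - xi) ^+ n)) => //.
  exact: alternating_qnumber_reflect hs.
have hg : converges abs (fermionic_sum p (q^-1 ^+ beta)
    (genocchi_integrand abs q^-1 alpha beta n 2%:R))
    ((1 + q^-1 ^+ beta) / 2%:R * s).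
  apply: (lims _ _ (fun xi => qnumber abs (q^-1 ^+ alpha) (2%:R + xi) ^+ n)) => //.
  by rewrite exprVn.
split; [by exists ((1 + q ^+ beta) / 2%:R * s) | by eexists; exact: hg |].
rewrite /genocchi /fermionic_integral (padic_limE CpK hf) (padic_limE CpK hg).
have qb0 : q ^+ beta != 0 by rewrite expf_neq0 // (near1_neq0 CpK).
(* The sides share [(n + 1) s / 2], and [q^-beta (1 + q^beta) = 1 + q^-beta]. *)
by rewrite exprVn; field; rewrite qb0 (two_neq0 p_prime CpK).
Qed.
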